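(* Let $X$ be a real Banach space and let $Y$ be a closed subspace of $X$ such that every separable (closed) subspace of $Y$ has property-$(HB)$ in $X$. Then $Y$ has property-$(HB)$ in $X$.
   Context: For a closed subspace $Y$ of $X$, $Y^\perp=\{x^*\in X^*: x^*(y)=0\ \forall y\in Y\}$. $Y$ has property-$(HB)$ in $X$ if there is a closed subspace $G$ of $X^*$ with $X^*=G\oplus Y^\perp$ such that for each $x^*\in X^*$, $\|x^*\|>\|y^\#\|$ and $\|x^*\|\ge\|y^\perp\|$ whenever $x^*=y^\#+y^\perp$ with $y^\#\in G$ and $0\ne y^\perp\in Y^\perp$. *)

(* Defs.v *)
From HB Require Import structures.
From mathcomp Require Import all_boot all_order all_algebra.
From mathcomp Require Import all_classical all_reals all_analysis.

Set Implicit Arguments.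
Unset Strict Implicit.
Unset Printing Implicit Defensive.

Import Order.TTheory GRing.Theory Num.Theory.
Import numFieldNormedType.Exports.

Local Open Scope classical_set_scope.
Local Open Scope ring_scope.

Section dual_space.
Context (R : realType) (X : normedModType R).

Definition clinear : {pred X -> R^o} :=
  mem [set f : X -> R^o | linear f /\ continuous f].

Record dual := Dual {
  dual_fun :> X -> R^o;
  dual_clinear : dual_fun \in clinear }.

HB.instance Definition _ := [isSub for dual_fun].
HB.instance Definition _ := [Choice of dual by <:].

Lemma clinear_submod_closed : submod_closed clinear.
Proof.
split.
  apply/mem_set; split => [a x y|]; last exact: cst_continuous.
  by rewrite scaler0 addr0.
move=> a f g /set_mem[fl fc] /set_mem[gl gc]; apply/mem_set; split.
  move=> b x y; rewrite !fctE fl gl !scalerDr !scalerA (mulrC b) -!addrA.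
  by congr (_ + _); rewrite addrCA.
move=> x; apply: (@continuousD R R^o X (a \*: f) g x); last exact: gc.
by apply: cvgZl_tmp; exact: fc.
Qed.

HB.instance Definition _ :=
  GRing.isSubmodClosed.Build R (X -> R^o) clinear clinear_submod_closed.
HB.instance Definition _ := [SubChoice_isSubLmodule of dual by <:].

Lemma dual_is_linear (f : dual) : linear f.
Proof. by case: f => f /= /set_mem[]. Qed.

HB.instance Definition _ (f : dual) :=
  GRing.isLinear.Build R X R^o *:%R f (dual_is_linear f).

Lemma dual_continuous (f : dual) : continuous f.
Proof. by case: f => f /= /set_mem[]. Qed.

Definition dual_norm (f : dual) : R := sup [set `|f x| | x in [set x | `|x| <= 1]].

Lemma dual_norm_has_sup (f : dual) :
  has_sup [set `|f x| | x in [set x | `|x| <= 1]].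
Proof.
split; first by exists `|f 0|, 0 => //=; rewrite normr0.
have := linear_bounded_continuous f.
move=> [_ /(_ (@dual_continuous f))] /bounded_funP/(_ 1)[M fM].
by exists M => _ [x /= x1 <-]; exact: fM.
Qed.

Lemma dual_norm_ge0 (f : dual) : 0 <= dual_norm f.
Proof.
apply: le_trans (ub_le_sup (dual_norm_has_sup f).2 _); last first.
  by exists 0 => //=; rewrite normr0.
exact: normr_ge0.
Qed.

Lemma le_dual_norm (f : dual) x : `|f x| <= dual_norm f * `|x|.
Proof.
have [->|x0] := eqVneq x 0; first by rewrite linear0 !normr0 mulr0.
rewrite -ler_pdivrMr ?normr_gt0//.
apply: ub_le_sup; first exact: (dual_norm_has_sup f).2.
exists (`|x|^-1 *: x) => /=.
  by rewrite normrZ normfV normr_id mulVf// normr_eq0.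
by rewrite linearZ normrZ normfV normr_id mulrC.
Qed.

Lemma dual_norm_le (f : dual) (M : R) :
  (forall x, `|x| <= 1 -> `|f x| <= M) -> dual_norm f <= M.
Proof.
move=> fM; apply: ge_sup; first exact: (dual_norm_has_sup f).1.
by move=> _ [x /= x1 <-]; exact: fM.
Qed.

Lemma dual_normD (f g : dual) : dual_norm (f + g) <= dual_norm f + dual_norm g.
Proof.
apply: dual_norm_le => x x1; rewrite (le_trans (ler_normD _ _))//.
by apply: lerD; apply: le_trans (le_dual_norm _ _) _; rewrite ler_piMr ?dual_norm_ge0.
Qed.

Lemma dual_normZ (a : R) (f : dual) : dual_norm (a *: f) = `|a| * dual_norm f.
Proof.
have le b g : dual_norm (b *: g) <= `|b| * dual_norm g.
  apply: dual_norm_le => x x1; rewrite [X in `|X|](_ : _ = b *: g x)//.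
  rewrite normrZ ler_wpM2l//; apply: le_trans (le_dual_norm _ _) _.
  by rewrite ler_piMr ?dual_norm_ge0.
apply/eqP; rewrite eq_le le/=; have [->|a0] := eqVneq a 0.
  by rewrite normr0 mul0r dual_norm_ge0.
rewrite -ler_pdivlMl ?normr_gt0// -normfV.
by rewrite -{1}(scale1r f) -(mulVf a0) -scalerA le.
Qed.

Lemma dual_norm_eq0 (f : dual) : dual_norm f = 0 -> f = 0.
Proof.
move=> f0; apply/val_inj/funext => x; apply/eqP.
by rewrite -normr_le0 (le_trans (le_dual_norm f x))// f0 mul0r.
Qed.

HB.instance Definition _ :=
  Lmodule_isNormed.Build R dual dual_normD dual_normZ dual_norm_eq0.

End dual_space.

Section subspaces.
Context (R : realType).

Definition closed_subspace (V : normedModType R) (Y : set V) : Prop :=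
  submod_closed (mem Y) /\ closed Y.

(* Separability for the subspace topology, [D] being taken inside [Y]. *)
Definition separable_set (V : normedModType R) (Y : set V) : Prop :=
  exists D : set V, [/\ countable D, D `<=` Y & Y `<=` closure D].

Definition direct_sum (V : normedModType R) (G H : set V) : Prop :=
  (forall v, exists g h, [/\ G g, H h & v = g + h]) /\ G `&` H = [set 0].

Definition annihilator (X : normedModType R) (Y : set X) : set (dual X) :=
  [set f | forall y, Y y -> f y = 0].

Definition property_HB (X : normedModType R) (Y : set X) : Prop :=
  exists G : set (dual X),
    [/\ closed_subspace G,
        direct_sum G (annihilator Y)
      & forall f g h : dual X, G g -> annihilator Y h -> h != 0 ->
          f = g + h -> `|g| < `|f| /\ `|h| <= `|f| ].

End subspaces.

(* Main.v *)
Require Import Defs.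
From HB Require Import structures.
From mathcomp Require Import all_boot all_order all_algebra.
From mathcomp Require Import all_classical all_reals all_analysis.
Import Order.TTheory GRing.Theory Num.Theory.
Import numFieldNormedType.Exports.
Local Open Scope classical_set_scope.
Local Open Scope ring_scope.

(** Say that [G] is an HB complement of [Z] when it witnesses property (HB) for
    [Z]. The strict inequality makes the [G]-component [g] of a functional [f]
    the unique element of least norm in the class of [f] modulo the annihilator
    of [Z]. Annihilators shrink when [Z] grows, so these minimal norms grow;
    this forces HB complements to be monotone: [Z `<=` Z'] implies [G `<=` G']
    ([HB_complement_mono]).

    Let [G_Y] be the union of the HB complements of the separable subsets [Z]
    of [Y] that have one. Countably many such subsets lie in a separable closed
    subspace of [Y] ([sequence_hull]), which has one by hypothesis, so by
    monotonicity countably many elements of [G_Y] lie in a single HB complement.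
    Hence [G_Y] is a closed subspace, since closedness only involves sequences.
    The two norm inequalities for [G_Y] and the triviality of its intersection
    with the annihilator of [Y] hold because the annihilator of [Y] is contained
    in that of every [Z `<=` Y].

    It remains to decompose a functional [f]. Among these subsets [Z],
    choose one whose component [g] of [f] has the largest norm; the supremum is
    attained by passing to the hull of a maximizing sequence
    ([separable_HB_maximal]). For every such [Z'] between [Z] and [Y], the
    component of [f] has norm at most that of [g], and strict minimality of [g]
    modulo the annihilator of [Z] shows that the two are equal. So [f - g]
    vanishes on every such [Z']; these cover [Y], since any point of [Y] can be
    adjoined to [Z]. *)

(** * Closed subspaces and separable hulls *)

Section closed_subspace_theory.
Context {R : realType} {V : normedModType R}.

Lemma closed_subspace0 {Y : set V} : closed_subspace Y -> Y 0.
Proof. by case=> -[Y0 _] _; rewrite inE in Y0. Qed.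

Lemma closed_subspaceP {Y : set V} (a : R) {u v : V} :
  closed_subspace Y -> Y u -> Y v -> Y (a *: u + v).
Proof.
by case=> -[_ Ylin] _ Yu Yv; have := Ylin a u v; rewrite !inE; apply.
Qed.

Lemma closed_subspaceI {Y : set V} :
    Y 0 -> (forall a u v, Y u -> Y v -> Y (a *: u + v)) -> closed Y ->
  closed_subspace Y.
Proof.
by move=> Y0 Ylin clY; split=> //; split=> [|a u v]; rewrite !inE//; exact: Ylin.
Qed.

(** Real scalars are limits of rational ones, so stability of [S] under
    rational combinations is enough. *)
Lemma closure_rational_subspace (S : set V) :
    S 0 -> (forall (q : rat) u v, S u -> S v -> S (ratr q *: u + v)) ->
  closed_subspace (closure S).
Proof.
move=> S0 Slin; apply: closed_subspaceI; last exact: closed_closure.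
  exact: subset_closure.
move=> a u v clu clv B nB.
(* Joint continuity of [(a, u, v) |-> a u + v] reduces to a rational scalar
   near [a] and points of [S] near [u] and [v]. *)
have cB : (fun p : (R^o * V) * V => p.1.1 *: p.1.2 + p.2) @ ((a, u), v) -->
    a *: u + v.
  apply: cvgD; last exact: cvg_snd.
  apply: cvgZ.
    apply: (@cvg_comp _ _ _ fst fst (nbhs ((a, u), v)) (nbhs (a, u))).
      exact: cvg_fst.
    exact: cvg_fst.
  apply: (@cvg_comp _ _ _ fst snd (nbhs ((a, u), v)) (nbhs (a, u))).
    exact: cvg_fst.
  exact: cvg_snd.
case: (cB B nB) => -[P Q] /= [[[A C] /= [nA nC] ACP] nQ] PQB.
have [x [Sx Cx]] := clu C nC; have [y [Sy Qy]] := clv Q nQ.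
have [r /= r0 rA] := (nbhs_ballP a A).1 nA.
have [|q] := @rat_in_itvoo R (a - r) (a + r).
  by rewrite ltrD2l gtrN.
rewrite in_itv/= => /andP[q1 q2].
exists (ratr q *: x + y); split; first exact: Slin.
apply: (PQB ((ratr q, x), y)); split=> //=; apply: ACP; split=> //=.
by apply: rA; rewrite /ball/= ltr_distlC q1 q2.
Qed.

(** The hull is the closure of the set of rational combinations, which is itself
    the countable dense subset required. *)
Lemma countable_hull (Y E : set V) : closed_subspace Y -> countable E ->
    E `<=` Y ->
  exists Z, [/\ closed_subspace Z, Z `<=` Y, separable_set Z & E `<=` Z].
Proof.
move=> hY cE EY.
(* [E] may be empty, hence an enumeration of a larger subset of [Y]. *)
have [e [Ye Ee]] : exists e : nat -> V, (forall n, Y (e n)) /\ E `<=` range e.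
  have [E0|[f]] := pfcard_geP cE.
    exists (fun=> 0); split=> [n|x]; first exact: closed_subspace0.
    by rewrite E0.
  exists f; split=> [n|]; first by apply: EY; exact: funS.
  by move=> x Ex; have [n _ <-] := 'surj_f Ex; exists n.
pose comb (s : seq (rat * nat)) : V := \sum_(p <- s) ratr p.1 *: e p.2.
have YS : range comb `<=` Y.
  move=> _ [s _ <-]; rewrite /comb; elim: s => [|p s IHs].
    by rewrite big_nil; exact: closed_subspace0.
  by rewrite big_cons; exact: closed_subspaceP.
exists (closure (range comb)); split.
- apply: closure_rational_subspace.
    by exists [::] => //; rewrite /comb big_nil.
  move=> q _ _ [s _ <-] [t _ <-].
  exists ([seq (q * p.1, p.2) | p <- s] ++ t) => //.
  rewrite /comb big_cat big_map scaler_sumr; congr (_ + _).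
  by apply: eq_bigr => p _; rewrite rmorphM scalerA.
- by case: hY => _ /closure_id ->; exact: closureS.
- exists (range comb); split=> //; last exact: subset_closure.
  exact/(card_le_trans (card_image_le _ _))/countableP.
- move=> x /Ee[n _ <-]; apply: subset_closure; exists [:: (1, n)] => //.
  by rewrite /comb big_seq1 rmorph1 scale1r.
Qed.

Lemma sequence_hull (Y : set V) (Zs : nat -> set V) : closed_subspace Y ->
    (forall n, Zs n `<=` Y) -> (forall n, separable_set (Zs n)) ->
  exists Z, [/\ closed_subspace Z, Z `<=` Y, separable_set Z &
    forall n, Zs n `<=` Z].
Proof.
move=> hY ZsY /choice[D hD].
have [||Z [hZ ZY sZ DZ]] := @countable_hull Y (\bigcup_n D n) hY.
- by apply: bigcup_countable => // n _; case: (hD n).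
- by move=> x [n _ Dx]; apply: (ZsY n); case: (hD n) => _ + _; exact.
exists Z; split=> // n x Zx; case: hZ => _ /closure_id ->.
case: (hD n) => _ _ /(_ _ Zx); apply: closureS => y Dy.
by apply: DZ; exists n.
Qed.

End closed_subspace_theory.

(** * Complements witnessing property (HB) *)

Section HB_complement_theory.
Context {R : realType} {X : normedModType R}.

Definition HB_complement (Z : set X) (G : set (dual X)) : Prop :=
  [/\ closed_subspace G,
      direct_sum G (annihilator Z)
    & forall f g h : dual X, G g -> annihilator Z h -> h != 0 ->
        f = g + h -> `|g| < `|f| /\ `|h| <= `|f| ].

Lemma annihilatorB (Z : set X) (f g : dual X) :
  annihilator Z f -> annihilator Z g -> annihilator Z (f - g).
Proof.
move=> fZ gZ x Zx; have -> : (f - g) x = f x - g x by [].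
by rewrite fZ// gZ// subrr.
Qed.

Lemma annihilatorS (Z Z' : set X) : Z `<=` Z' ->
  annihilator Z' `<=` annihilator Z.
Proof. by move=> ZZ' f fZ' x /ZZ'; exact: fZ'. Qed.

(** Restates the norm condition on decompositions as strict minimality of [g]
    in its class modulo the annihilator, where two elements can be compared
    without naming their difference. *)
Lemma HB_complement_lt {Z : set X} {G} {g f : dual X} : HB_complement Z G ->
  G g -> annihilator Z (f - g) -> f != g -> `|g| < `|f|.
Proof.
move=> [_ _ norm_lt] Gg fgZ fg.
have fE : f = g + (f - g) by rewrite addrC subrK.
have fg0 : f - g != 0 by rewrite subr_eq0.
by have [] := norm_lt _ _ _ Gg fgZ fg0 fE.
Qed.

(** If [g] in [G] had a component [g'] in [G'] other than [g], then [g'] would be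
    strictly smaller than [g] by minimality for [Z'], and strictly larger by
    minimality for [Z], as the two agree on [Z `<=` Z']. With [Z = Z'] this is
    the uniqueness of the HB complement. *)
Lemma HB_complement_mono {Z Z' : set X} {G G'} : HB_complement Z G ->
  HB_complement Z' G' -> Z `<=` Z' -> G `<=` G'.
Proof.
move=> hG hG' ZZ' g Gg; case: (hG') => _ [/(_ g)[g' [h [G'g' hZ' gE]]] _] _.
have [->//|gg'] := eqVneq g g'.
have hE : h = g - g' by rewrite gE addrC addKr.
have lt1 : `|g'| < `|g| by apply: (HB_complement_lt hG') => //; rewrite -hE.
have lt2 : `|g| < `|g'|.
  apply: (HB_complement_lt hG) => //; last by rewrite eq_sym.
  rewrite -opprB -hE -sub0r; apply: annihilatorB => //.
  exact: annihilatorS hZ'.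
by have := lt_trans lt1 lt2; rewrite ltxx.
Qed.

Lemma HB_complement_le {Z : set X} {G} {g f : dual X} : HB_complement Z G ->
  G g -> annihilator Z (f - g) -> `|g| <= `|f|.
Proof.
move=> hG Gg fgZ; have [->//|fg] := eqVneq f g.
exact/ltW/(HB_complement_lt hG).
Qed.

End HB_complement_theory.

(** * Gluing the complements of separable subspaces *)

Section separably_determined.
Context {R : realType} {X : normedModType R} (Y : set X).
Context (hY : closed_subspace Y).
Context (hsep : forall Z : set X, closed_subspace Z -> Z `<=` Y ->
  separable_set Z -> property_HB Z).

Definition separable_HB_pair (Z : set X) (G : set (dual X)) : Prop :=
  [/\ Z `<=` Y, separable_set Z & HB_complement Z G].

Definition separable_HB_union : set (dual X) :=
  [set f | exists Z G, separable_HB_pair Z G /\ G f].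

(** Separable subsets with their complements form a countably directed family;
    the complements follow the subsets by monotonicity. *)
Lemma separable_HB_pair_seq (Zs : nat -> set X) (Gs : nat -> set (dual X)) :
    (forall n, separable_HB_pair (Zs n) (Gs n)) ->
  exists Z G, [/\ separable_HB_pair Z G, forall n, Zs n `<=` Z &
    forall n, Gs n `<=` G].
Proof.
move=> hZs; have [n|n|Z [hZ ZY sZ ZsZ]] := @sequence_hull _ _ Y Zs hY.
- by case: (hZs n).
- by case: (hZs n).
have [G hG] := hsep _ hZ ZY sZ.
exists Z, G; split=> // n; case: (hZs n) => _ _ hGn.
exact: HB_complement_mono hGn hG (ZsZ n).
Qed.

Lemma separable_HB_union_seq (u : nat -> dual X) :
    (forall n, separable_HB_union (u n)) ->
  exists Z G, separable_HB_pair Z G /\ forall n, G (u n).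
Proof.
move=> /choice[Zs] /choice[Gs hu].
have [n|Z [G [hZG _ GsG]]] := @separable_HB_pair_seq Zs Gs; first by case: (hu n).
by exists Z, G; split=> // n; apply: (GsG n); case: (hu n).
Qed.

Lemma separable_HB_pair_point (y : X) : Y y ->
  exists Z G, separable_HB_pair Z G /\ Z y.
Proof.
move=> Yy; have [||Z [hZ ZY sZ yZ]] := @countable_hull _ _ Y [set y] hY.
- exact: countable1.
- by move=> _ ->.
have [G hG] := hsep _ hZ ZY sZ.
by exists Z, G; split=> //; exact: yZ.
Qed.

Lemma separable_HB_pair2 {Z1 Z2 : set X} {G1 G2} :
    separable_HB_pair Z1 G1 -> separable_HB_pair Z2 G2 ->
  exists Z G, [/\ separable_HB_pair Z G, Z1 `<=` Z, Z2 `<=` Z,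
    G1 `<=` G & G2 `<=` G].
Proof.
move=> h1 h2.
have [[|n]//|Z [G [hZG ZsZ GsG]]] := @separable_HB_pair_seq
  (fun n => if n is 0%N then Z1 else Z2) (fun n => if n is 0%N then G1 else G2).
exists Z, G; split=> //.
- exact: ZsZ 0%N.
- exact: ZsZ 1%N.
- exact: GsG 0%N.
- exact: GsG 1%N.
Qed.

Lemma separable_HB_union_closed_subspace : closed_subspace separable_HB_union.
Proof.
apply: closed_subspaceI.
- have [Z [G [hZG _]]] := separable_HB_pair_point _ (closed_subspace0 hY).
  exists Z, G; split=> //; case: hZG => _ _ [hG _ _]; exact: closed_subspace0.
- move=> a f g [Z1 [G1 [h1 Gf]]] [Z2 [G2 [h2 Gg]]].
  have [Z [G [hZG _ _ G1G G2G]]] := separable_HB_pair2 h1 h2.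
  exists Z, G; split=> //; case: hZG => _ _ [hG _ _].
  by apply: closed_subspaceP => //; [exact: G1G|exact: G2G].
- move=> f clf.
  have /choice[u hu] : forall n : nat, exists g : dual X,
      separable_HB_union g /\ ball f n.+1%:R^-1 g.
    move=> n; have [|g [? ?]] := clf (ball f n.+1%:R^-1); last by exists g.
    by apply: nbhsx_ballx; rewrite invr_gt0 ltr0n.
  have [|Z [G [hZG Gu]]] := separable_HB_union_seq u; first by move=> n; case: (hu n).
  exists Z, G; split=> //; case: hZG => _ _ [[_ clG] _ _].
  apply: clG => B /nbhs_ballP[r /= r0 rB].
  have [n] := ltr_add_invr r0; rewrite add0r => nr.
  exists (u n); split=> //; apply: rB; case: (hu n) => _.
  exact/le_ball/ltW.
Qed.

(** The norms of the components of [f] are bounded by the norm of [f]. A hull of a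
    maximizing sequence of subsets attains their supremum, because components
    grow in norm with the subset. *)
Lemma separable_HB_maximal (f : dual X) :
  exists Z G g, [/\ separable_HB_pair Z G, G g, annihilator Z (f - g) &
    forall Z' G' g', separable_HB_pair Z' G' -> G' g' ->
      annihilator Z' (f - g') -> `|g'| <= `|g|].
Proof.
pose N := [set r : R | exists Z G g, [/\ separable_HB_pair Z G, G g,
  annihilator Z (f - g) & r = `|g|]].
have split_f Z G : separable_HB_pair Z G -> exists g, G g /\ annihilator Z (f - g).
  case=> _ _ [_ [/(_ f)[g [h [Gg hZ fE]]] _] _].
  by exists g; split=> //; rewrite fE addrC addKr.
have supN : has_sup N.
  split.
    have [Z [G [hZG _]]] := separable_HB_pair_point _ (closed_subspace0 hY).
    have [g [Gg gZ]] := split_f _ _ hZG.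
    by exists `|g|, Z, G, g.
  exists `|f| => _ [Z [G [g [[_ _ hG] Gg gZ ->]]]].
  exact: HB_complement_le hG Gg gZ.
have /choice[Zs /choice[Gs /choice[gs hgs]]] : forall n : nat, exists Z G g,
    [/\ separable_HB_pair Z G, G g, annihilator Z (f - g) &
        sup N - n.+1%:R^-1 < `|g|].
  move=> n; have n0 : 0 < n.+1%:R^-1 :> R by rewrite invr_gt0 ltr0n.
  have [_ [Z [G [g [? ? ? ->]]]] ltg] := sup_adherent n0 supN.
  by exists Z, G, g.
have [n|Z [G [hZG ZsZ _]]] := separable_HB_pair_seq Zs Gs; first by case: (hgs n).
have [g [Gg gZ]] := split_f _ _ hZG.
exists Z, G, g; split=> // Z' G' g' hZG' Gg' gZ'.
apply: (@le_trans _ _ (sup N)).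
  by apply: ub_le_sup; [exact: supN.2|exists Z', G', g'].
rewrite leNgt; apply/negP => /ltr_add_invr[n gn].
case: (hgs n) => -[_ _ hGn] Ggn fgnZ ltn.
(* [gs n] and [g] agree on [Zs n], where [gs n] has least norm. *)
have : `|gs n| <= `|g|.
  apply: (HB_complement_le hGn) => //.
  have -> : g - gs n = (f - gs n) - (f - g) by rewrite opprB [RHS]addrC addrA subrK.
  by apply: annihilatorB => //; apply: annihilatorS gZ; exact: ZsZ.
rewrite leNgt => /negP; apply; apply: lt_trans ltn.
by rewrite ltrBrDr.
Qed.

(** Adjoining a point [y] of [Y] to a maximal [Z] cannot change the component [g],
    so [f - g] vanishes at [y]. *)
Lemma separable_HB_decomposition (f : dual X) :
  exists g, separable_HB_union g /\ annihilator Y (f - g).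
Proof.
have [Z [G [g [hZG Gg gZ gmax]]]] := separable_HB_maximal f.
exists g; split=> [|y Yy]; first by exists Z, G.
have [L [H [hLH Ly]]] := separable_HB_pair_point y Yy.
have [Z' [G' [hZG' ZZ' LZ' GG' _]]] := separable_HB_pair2 hZG hLH.
case: (hZG') => _ _ [_ [/(_ f)[g' [h [G'g' hZ' fE]]] _] _].
have hE : h = f - g' by rewrite fE addrC addKr.
have g'g : `|g'| <= `|g| by apply: (gmax Z' G') => //; rewrite -hE.
have gg' : g' = g.
  apply/eqP; apply: contraT => ne; move: g'g; rewrite leNgt => /negP[].
  case: hZG => _ _ hG; apply: (HB_complement_lt hG) => //.
  have -> : g' - g = (f - g) - (f - g') by rewrite opprB [RHS]addrC addrA subrK.
  by rewrite -hE; apply: annihilatorB => //; exact: annihilatorS hZ'.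
by rewrite -gg' -hE; apply: hZ'; exact: LZ'.
Qed.

Lemma separable_HB_union_complement : HB_complement Y separable_HB_union.
Proof.
split; first exact: separable_HB_union_closed_subspace.
- split.
    move=> f; have [g [Gg gY]] := separable_HB_decomposition f.
    by exists g, (f - g); split=> //; rewrite addrC subrK.
  apply/seteqP; split=> [f [[Z [G [[ZY _ [_ [_ GZ0] _]] Gf]]] fY]|_ ->].
    by rewrite -GZ0; split=> //; exact: annihilatorS fY.
  split=> //; exact: closed_subspace0 separable_HB_union_closed_subspace.
- move=> f g h [Z [G [[ZY _ [_ _ norm_lt]] Gg]]] hY' h0 fE.
  by apply: norm_lt => //; exact: annihilatorS hY'.
Qed.

End separably_determined.

Theorem proposition2p19 (R : realType) (X : completeNormedModType R)
    (Y : set X) (hY : closed_subspace Y)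
    (hsep : forall Z : set X, closed_subspace Z -> Z `<=` Y ->
      separable_set Z -> property_HB Z) :
  property_HB Y.
Proof.
exists (separable_HB_union Y); exact: separable_HB_union_complement.
Qed.
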